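(* Let $\mathbf U\subset\mathbb R^2$ be the set of couples $(x,q)$ with $q>1$ such that $x$ has exactly one expansion in base $q$ (i.e. exactly one sequence $(c_i)_{i\ge1}$ of integers with $0\le c_i<q$ for all $i$ and $x=\sum_{i=1}^\infty c_iq^{-i}$). Let $\overline{\mathbf U}$ denote its closure in $\mathbb R^2$. Then: (i) $\mathbf U$ is not closed, and $\overline{\mathbf U}$ is a Cantor set, i.e. a nonempty closed set having neither interior points nor isolated points; (ii) both $\mathbf U$ and $\overline{\mathbf U}$ have two-dimensional Lebesgue measure zero; (iii) both $\mathbf U$ and $\overline{\mathbf U}$ have Hausdorff dimension $2$.
   Context: For $q>1$, an expansion of $x$ in base $q$ is a sequence $(c_i)_{i\ge1}$ of integers with $0\le c_i<q$ for all $i$ and $x=\sum_{i\ge1}c_iq^{-i}$. The closure is taken in $\mathbb R^2$ with its usual topology. *)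

(* Defs.v *)
From HB Require Import structures.
From mathcomp Require Import all_boot all_order all_algebra.
From mathcomp Require Import all_classical all_reals all_analysis.
Set Implicit Arguments. Unset Strict Implicit. Unset Printing Implicit Defensive.
Import Order.TTheory GRing.Theory Num.Theory.
Import numFieldNormedType.Exports.
Local Open Scope classical_set_scope.
Local Open Scope ring_scope.

(* (c_i)_{i>=1} is encoded as c : nat -> nat with c k standing for c_{k+1}. *)
Definition is_expansion {R : realType} (q x : R) (c : nat -> nat) : Prop :=
  (forall k, (c k)%:R < q) /\
  (series (fun k => (c k)%:R / q ^+ k.+1)) @ \oo --> x.

Definition Uset {R : realType} : set (R * R) :=
  [set p | 1 < p.2 /\ exists! c, is_expansion p.2 p.1 c].

Definition edist2 {R : realType} (p p' : R * R) : R :=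
  Num.sqrt ((p.1 - p'.1) ^+ 2 + (p.2 - p'.2) ^+ 2).

(* Diameter (convention: diam of the empty set is 0) *)
Definition diam2 {R : realType} (A : set (R * R)) : \bar R :=
  ereal_sup ([set 0%E] `|` [set (edist2 p p')%:E | p in A & p' in A]).

Definition hausdorff_pre {R : realType} (s d : R) (A : set (R * R)) : \bar R :=
  ereal_inf [set (\sum_(0 <= i <oo) ((powR (fine (diam2 (E i))) s)%:E))%E
            | E in [set E : nat -> set (R * R) |
                     A `<=` \bigcup_i E i /\ forall i, (diam2 (E i) <= d%:E)%E]].

Definition hausdorff_measure {R : realType} (s : R) (A : set (R * R)) : \bar R :=
  ereal_sup [set hausdorff_pre s d A | d in [set d : R | 0 < d]].

Definition hausdorff_dim {R : realType} (A : set (R * R)) : \bar R :=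
  ereal_inf [set s%:E | s in [set s : R | 0 <= s /\ hausdorff_measure s A = 0%E]].

Definition lebesgue2 {R : realType} :=
  (@lebesgue_measure R \x @lebesgue_measure R)%E.

(* Main.v *)
(* For q in (m, m+1] the digits are 0, ..., m.  Writing T_n for the number that
   the digits after the n-th one represent, an expansion is unique exactly when
   c_n < m implies T_n < 1 and c_n > 0 implies m/(q-1) - T_n < 1: otherwise the
   digit can be raised or lowered and completed greedily.  These inequalities
   persist when q grows inside (m, m+1], so a point of U with a non-integer base
   moves inside U along a curve of constant digits; in an integer base all
   irrational numbers of [0, 1] have a unique expansion.  Hence no point is
   isolated.  All the points (0, q) belong to U, so its closure contains (0, 1).

   A number whose n-th remainder r satisfies 1 < q r < m/(q-1) has two
   expansions, with next digit 0 and 1.  This condition is open in (x, q), so it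
   excludes points of the closure too, and it puts holes of proportional size at
   every scale around each point of the slice at a non-integer q.  By the
   Lebesgue density theorem these slices are null, and Fubini applies.

   If only the digits 1, ..., m-1 are used, the inequalities hold for all q in
   (m, m+1].  The corresponding slices have dimension at least
   ln(m-1)/ln(m+1), with uniform constants, and integrating over q the
   mass-distribution inequality of the slices adds one to this dimension, which
   tends to 2 as m grows. *)
Require Import Defs.
From HB Require Import structures.
From mathcomp Require Import all_boot all_order all_algebra.
From mathcomp Require Import all_classical all_reals all_analysis.
From mathcomp Require Import measurable_realfun ring lra zify.
Import Order.TTheory GRing.Theory Num.Theory.
Import numFieldNormedType.Exports.
Local Open Scope classical_set_scope.
Local Open Scope ring_scope.
Set Implicit Arguments.
Unset Strict Implicit.

(** * Expansions through their remainders *)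

Lemma expr_unbounded {R : realType} (q B : R) : 1 < q -> exists n, B < q ^+ n.
Proof.
move=> q1.
have bern n : n%:R * (q - 1) <= q ^+ n.
  elim: n => [|n IH]; first by rewrite mul0r expr0.
  have qn : 1 <= q ^+ n by apply: exprn_ege1; exact: ltW.
  rewrite exprS -natr1; nra.
have q10 : 0 < q - 1 by lra.
exists (Num.truncn (`|B| / (q - 1))).+1.
apply: lt_le_trans (bern _); rewrite -ltr_pdivrMr//.
apply: le_lt_trans (truncnS_gt _).
by rewrite ler_pM2r ?invr_gt0// ler_norm.
Qed.

(** A positive start would grow like [q ^+ n] and pass any bound. Later comparisons of remainders
    apply this to a difference that each step multiplies by at least [q]. *)
Lemma expanding_le0 {R : realType} (q B : R) (a : nat -> R) : 1 < q ->
  (forall n, q * a n <= a n.+1) -> (forall n, a n <= B) -> a 0%N <= 0.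
Proof.
move=> q1 aS aB; rewrite leNgt; apply/negP => a0.
have an n : q ^+ n * a 0%N <= a n.
  elim: n => [|n IH]; first by rewrite expr0 mul1r.
  apply: le_trans (aS n); rewrite exprS -mulrA ler_pM2l//; lra.
have [n nB] := expr_unbounded (B / a 0%N) q1.
have := le_trans (an n) (aB n); rewrite leNgt => /negP; apply.
by rewrite -ltr_pdivrMr.
Qed.

(* [rest q x c n] is [q ^+ n * (x - S_n)], where [S_n] is the sum of the first
   [n] terms of the series with digits [c]: the real number that the digits
   from [c n] on have to represent. *)
Fixpoint rest {R : realType} (q x : R) (c : nat -> nat) (n : nat) : R :=
  if n is k.+1 then q * rest q x c k - (c k)%:R else x.

(** [m / (q - 1)] is the value of the constant digit sequence [m], the largest one. Keeping every
    remainder between 0 and this value replaces convergence of the series. *)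
Definition codes {R : realType} (q : R) (m : nat) (x : R) (c : nat -> nat) : Prop :=
  (forall k, (c k <= m)%N) /\ (forall n, 0 <= rest q x c n <= m%:R / (q - 1)).

Lemma restE {R : realType} (q x : R) c n : q != 0 ->
  rest q x c n = q ^+ n * (x - series (fun k => (c k)%:R / q ^+ k.+1) n).
Proof.
move=> q0; elim: n => [|n IH]; first by rewrite /= mul1r /series/= big_geq// subr0.
rewrite seriesSr opprD addrA [in RHS]mulrDr mulrN [in RHS]mulrCA mulfV ?expf_neq0//.
by rewrite mulr1 exprS -mulrA -IH.
Qed.

Lemma rest_add {R : realType} (q x : R) c n k :
  rest q x c (n + k) = rest q (rest q x c n) (fun i => c (n + i)%N) k.
Proof. by elim: k => [|k IH]; rewrite ?addn0// addnS /= IH. Qed.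

Lemma eq_rest {R : realType} (q x : R) c d n :
  (forall k, (k < n)%N -> c k = d k) -> rest q x c n = rest q x d n.
Proof.
elim: n => //= n IH cd; rewrite cd// IH// => k kn; apply: cd; exact: ltnW.
Qed.

Lemma rest_sub {R : realType} (q x y : R) c n :
  rest q x c n - rest q y c n = q ^+ n * (x - y).
Proof. by elim: n => [|n IH]; [rewrite mul1r|rewrite exprS -mulrA -IH /=; ring]. Qed.

Lemma codes_shift {R : realType} (q : R) m x c n : codes q m x c ->
  codes q m (rest q x c n) (fun i => c (n + i)%N).
Proof. by case=> cm xc; split => // k; rewrite -rest_add. Qed.

Lemma codes_inj {R : realType} (q : R) m x y c : 1 < q ->
  codes q m x c -> codes q m y c -> x = y.
Proof.
move=> q1 [_ xc] [_ yc].
have aux (u v : R) : (forall n, 0 <= rest q u c n <= m%:R / (q - 1)) ->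
    (forall n, 0 <= rest q v c n <= m%:R / (q - 1)) -> u <= v.
  move=> uc vc; rewrite -subr_le0.
  apply: (@expanding_le0 _ q (m%:R / (q - 1)) (fun n => rest q u c n - rest q v c n)) => // n.
    by rewrite !rest_sub exprS mulrA.
  by have := uc n; have := vc n; lra.
by apply/eqP; rewrite eq_le !aux.
Qed.

Lemma expansionP {R : realType} (q : R) (m : nat) x c : 1 < q ->
  m%:R < q <= m.+1%:R -> is_expansion q x c <-> codes q m x c.
Proof.
move=> q1 /andP[mq qm].
have q0 : 0 < q by lra.
have dm : (forall k, (c k)%:R < q) <-> (forall k, (c k <= m)%N).
  split=> h k; first by rewrite -ltnS -(ltr_nat R); exact: lt_le_trans (h k) _.
  by apply: le_lt_trans mq; rewrite ler_nat.
rewrite /is_expansion /codes; set M := m%:R / (q - 1).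
have M0 : 0 <= M by rewrite divr_ge0//; lra.
have bE : M * (q - 1) = m%:R by rewrite divfK//; lra.
set u := series (fun k => _).
have uS k : u k.+1 = u k + (c k)%:R / q ^+ k.+1 by rewrite /u seriesSr.
split => [[/dm cm cvg]|[/dm cq cb]]; split => //.
(* The partial sums increase to [x] and [u n + M / q ^+ n] decreases to it. Multiplied by [q ^+ n],
   this enclosure is the bound on the remainder. *)
- have un n : u n <= x.
    rewrite -(cvg_lim (@Rhausdorff R) cvg); apply: nondecreasing_cvgn_le; last exact: cvgP cvg.
    by apply/nondecreasing_seqP => k; rewrite uS lerDl divr_ge0// exprn_ge0// ltW.
  have vS k : u k.+1 + M / q ^+ k.+1 <= u k + M / q ^+ k.
    have ck : (c k)%:R <= m%:R :> R by rewrite ler_nat.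
    rewrite uS -addrA lerD2l -mulrDl -ler_pdivlMr ?invr_gt0 ?exprn_gt0// invrK exprS.
    rewrite mulrCA divfK ?expf_neq0 ?gt_eqF//; lra.
  have vn n N : u (n + N)%N + M / q ^+ (n + N) <= u n + M / q ^+ n.
    elim: N => [|N IH]; first by rewrite addn0.
    by rewrite addnS; exact: le_trans (vS _) IH.
  have xv n : x <= u n + M / q ^+ n.
    rewrite -(cvg_lim (@Rhausdorff R) cvg); apply: limr_le; first exact: cvgP cvg.
    exists n => // k /= nk; have := vn n (k - n)%N; rewrite subnKC//.
    by apply: le_trans; rewrite lerDl divr_ge0 ?exprn_ge0// ltW.
  move=> n; rewrite restE ?gt_eqF// mulr_ge0 ?exprn_ge0 ?subr_ge0 ?(ltW q0)//=.
  by rewrite mulrC -ler_pdivlMr ?exprn_gt0// lerBlDl.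
have uE n : u n = x - rest q x c n * q^-1 ^+ n.
  rewrite restE ?gt_eqF// exprVn mulrC mulKf ?expf_neq0 ?gt_eqF//.
  by rewrite opprB addrC subrK.
rewrite -/u; apply: (@squeeze_cvgr _ _ _ _ (fun n => x - M * q^-1 ^+ n) (fun n => x)).
- apply: nearW => n /=; rewrite uE; have /andP[a b] := cb n.
  have p : 0 <= q^-1 ^+ n by rewrite exprn_ge0// invr_ge0 ltW.
  by rewrite lerD2l lerN2 ler_wpM2r//= gerBl mulr_ge0.
- rewrite -[X in _ --> X]subr0; apply: cvgB; first exact: cvg_cst.
  rewrite -(mulr0 M); apply: cvgMr; apply: cvg_expr.
  by rewrite ger0_norm ?invr_ge0 ?ltW// invf_lt1.
- exact: cvg_cst.
Qed.

(** The digit is the integer part of [q * t], cut off at [m]. Without cut-off the new remainder is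
    below 1, and [1 <= M] because [q <= m + 1]; with it, [q * M - m = M] bounds the remainder. *)
Lemma greedy {R : realType} (q : R) (m : nat) (x : R) : 1 < q -> q <= m.+1%:R ->
  0 <= x <= m%:R / (q - 1) -> exists c, codes q m x c.
Proof.
move=> q1 qm x0M; set M := m%:R / (q - 1) in x0M.
have ME : M * (q - 1) = m%:R by rewrite divfK//; lra.
have M1 : 1 <= M by rewrite ler_pdivlMr; rewrite -natr1 in qm; lra.
have step (t : R) : exists d : nat, 0 <= t <= M -> (d <= m)%N /\ 0 <= q * t - d%:R <= M.
  have [t0M|] := boolP (0 <= t <= M); last by exists 0%N.
  have /andP[t0 tM] := t0M; have qt0 : 0 <= q * t by rewrite mulr_ge0//; lra.
  have /andP[d1 d2] := truncn_itv qt0; rewrite -natr1 in d2.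
  have [dm|md] := leqP (Num.truncn (q * t)) m.
    by exists (Num.truncn (q * t)) => _; split => //; lra.
  exists m => _; split => //; have : m.+1%:R <= (Num.truncn (q * t))%:R :> R by rewrite ler_nat.
  rewrite -natr1; nra.
have [g gP] := boolp.choice step.
pose T n := iter n (fun t => q * t - (g t)%:R) x.
have TM n : 0 <= T n <= M by elim: n => // n IH; have [] := gP _ IH.
exists (fun n => g (T n)); split => [k|n]; first by have [] := gP _ (TM k).
suff -> : rest q x (fun n => g (T n)) n = T n by exact: TM.
by elim: n => //= n ->.
Qed.

(** Only the remainder at the end of the prefix needs checking. Going backwards, the earlier one is
    [(r + a) / q] with [r <= M] and [a <= m], and [(M + m) / q = M]. *)
Lemma codes_graft {R : realType} (q : R) (m : nat) (x : R) c n : 1 < q -> q <= m.+1%:R ->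
  (forall k, (k < n)%N -> (c k <= m)%N) -> 0 <= rest q x c n <= m%:R / (q - 1) ->
  exists2 d, codes q m x d & forall k, (k < n)%N -> d k = c k.
Proof.
move=> q1 qm cm rM; have [e [em eM]] := greedy q1 qm rM.
set M := m%:R / (q - 1) in rM eM.
have ME : M * (q - 1) = m%:R by rewrite divfK//; lra.
pose d k := if (k < n)%N then c k else e (k - n)%N.
have dc k : (k < n)%N -> d k = c k by rewrite /d => ->.
exists d => //; split => k; first by rewrite /d; case: ifP => // kn; exact: cm.
have rn : rest q x d n = rest q x c n by exact: eq_rest.
have [kn|/ltnW/subnKC <-] := leqP k n; last first.
  rewrite rest_add rn (_ : (fun i => _) = e)//; apply/funext => i.
  by rewrite /d ltnNge leq_addr/= addKn.
rewrite -(subKn kn); elim: (n - k)%N (leq_subr k n) => [|j IH jn]; first by rewrite subn0 rn.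
have := IH (ltnW jn); rewrite -/M.
have dm : (d (n - j.+1) <= m)%N by rewrite dc ?cm//; lia.
have -> : (n - j)%N = (n - j.+1).+1 by lia.
move=> /=; have : (d (n - j.+1)%N)%:R <= m%:R :> R by rewrite ler_nat.
have : 0 <= (d (n - j.+1)%N)%:R :> R by [].
move: (d _)%:R (rest _ _ _ _) => a r a0 am /andP[h1 h2].
by apply/andP; split; nra.
Qed.

(** * Uniqueness of expansions *)

Lemma base_digits {R : realType} (q : R) : 1 < q -> exists m : nat, m%:R < q <= m.+1%:R.
Proof.
move=> q1; have /andP[nq qn] : (Num.truncn q)%:R <= q < (Num.truncn q).+1%:R.
  by apply: truncn_itv; lra.
have [qE|qN] := eqVneq (Num.truncn q)%:R q; last first.
  by exists (Num.truncn q); rewrite lt_neqAle qN nq ltW.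
(* An integer base [n + 1] has largest digit [n], so it sits at the right end of its interval. *)
case: (Num.truncn q) qE => [|n qE]; first by move=> q0; rewrite -q0 in q1; lra.
by exists n; rewrite -qE ltr_nat ltnSn lexx.
Qed.

Lemma UsetP {R : realType} (q : R) (m : nat) x : 1 < q -> m%:R < q <= m.+1%:R ->
  Uset (x, q) <-> exists! c, codes q m x c.
Proof.
move=> q1 mqm; split => [[_ [c [/= xc uc]]]|[c [xc uc]]].
  exists c; split; first exact/(expansionP x c q1 mqm).
  by move=> d /(expansionP x d q1 mqm); exact: uc.
split => //=; exists c; split; first exact/(expansionP x c q1 mqm).
by move=> d /(expansionP x d q1 mqm); exact: uc.
Qed.

(** Both prefixes extend to full expansions by [codes_graft], so uniqueness can be exploited on
    finitely many digits. *)
Lemma Uset_prefix {R : realType} (q : R) (m : nat) x c d n : 1 < q ->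
  m%:R < q <= m.+1%:R -> Uset (x, q) ->
  (forall k, (k < n)%N -> (c k <= m)%N) -> (forall k, (k < n)%N -> (d k <= m)%N) ->
  0 <= rest q x c n <= m%:R / (q - 1) -> 0 <= rest q x d n <= m%:R / (q - 1) ->
  forall k, (k < n)%N -> c k = d k.
Proof.
move=> q1 mqm /(UsetP x q1 mqm) [e [_ eu]] cm dm rc rd k kn.
have /andP[_ qm] := mqm.
have [c' /eu ec' <-//] := codes_graft q1 qm cm rc.
by have [d' /eu ed' <-//] := codes_graft q1 qm dm rd; rewrite -ec' -ed'.
Qed.

Definition strict_codes {R : realType} (q : R) (m : nat) x c :=
  codes q m x c /\ forall n, ((c n < m)%N -> rest q x c n.+1 < 1) /\
    ((0 < c n)%N -> m%:R / (q - 1) - rest q x c n.+1 < 1).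

(* If some remainder is at least [1] (or the complementary one is), the digit
   before it can be raised (or lowered) by one and the expansion completed
   greedily, which gives a second expansion. *)
Lemma Uset_strict {R : realType} (q : R) (m : nat) x : 1 < q -> m%:R < q <= m.+1%:R ->
  Uset (x, q) -> exists c, strict_codes q m x c.
Proof.
move=> q1 mqm Ux; have [c [[cm cM] _]] := (UsetP x q1 mqm).1 Ux.
exists c; split => // n.
have alt j : (j <= m)%N ->
    0 <= q * rest q x c n - j%:R <= m%:R / (q - 1) -> c n = j.
  move=> jm rj; pose d k := if k == n then j else c k.
  have dn : d n = j by rewrite /d eqxx.
  rewrite -dn.
  apply: (Uset_prefix (n := n.+1) q1 mqm Ux) => //.
    by move=> k _; rewrite /d; case: ifP.
  rewrite /= dn (@eq_rest _ q x d c n)// => k kn.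
  by rewrite /d; case: eqP => // kE; rewrite kE ltnn in kn.
have /andP[r0 rM] := cM n.+1; rewrite /= in r0 rM.
split => cn; rewrite ltNge; apply/negP => r1; rewrite /= in r1.
  suff : c n = (c n).+1 by move/eqP; rewrite -[X in X == _]addn0 -addn1 eqn_add2l.
  by apply: alt => //; rewrite -natr1; lra.
suff cp : c n = (c n).-1 by have := ltn_predL (c n); rewrite -cp ltnn cn.
have cE : (c n)%:R = (c n).-1%:R + 1 :> R by rewrite natr1 prednK.
by apply: alt; [exact: leq_trans (leq_pred _) (cm n)|lra].
Qed.

(** Where a second expansion first departs from [c], its next remainder differs from that of [c] by
    a nonzero integer. The strict bounds then push it below 0 or above [m / (q - 1)]. *)
Lemma strict_Uset {R : realType} (q : R) (m : nat) x c : 1 < q -> m%:R < q <= m.+1%:R ->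
  strict_codes q m x c -> Uset (x, q).
Proof.
move=> q1 mqm [xc cs]; apply/(UsetP x q1 mqm); exists c; split => // d [dm dM].
have [cm cM] := xc.
apply/funext => k; apply/eqP/negPn/negP => cd.
have exn : exists n, c n != d n by exists k.
have [n cdn nmin] := ex_minnP exn.
have rE : rest q x c n = rest q x d n.
  apply: eq_rest => j jn; apply/eqP/negPn/negP => /nmin; lia.
have [c1 c2] := cs n.
have := dM n.+1; have := cM n.+1; rewrite /= -rE => h1 h2.
move: cdn; rewrite neq_ltn => /orP[cd1|cd1].
  have : (c n).+1%:R <= (d n)%:R :> R by rewrite ler_nat.
  have := c1 (leq_trans cd1 (dm n)); rewrite -natr1 /=; lra.
have : (d n).+1%:R <= (c n)%:R :> R by rewrite ler_nat.
have := c2 (leq_ltn_trans (leq0n _) cd1); rewrite -natr1 /=; lra.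
Qed.

Lemma codes_exists {R : realType} (q : R) (m : nat) c : 1 < q -> m%:R < q <= m.+1%:R ->
  (forall k, (c k <= m)%N) -> exists x, codes q m x c.
Proof.
move=> q1 mqm cm; have q0 : 0 < q by lra.
suff cv : cvgn (series (fun k => (c k)%:R / q ^+ k.+1)).
  exists (limn (series (fun k => (c k)%:R / q ^+ k.+1))).
  apply/(expansionP _ c q1 mqm); split => // k.
  by have /andP[+ _] := mqm; apply: le_lt_trans; rewrite ler_nat.
apply: (@series_le_cvg _ _ (geometric (m%:R / q) q^-1)) => [n|n|n|].
- by rewrite divr_ge0// exprn_ge0// ltW.
- by rewrite /geometric/= !mulr_ge0// ?exprn_ge0// invr_ge0 ltW.
- rewrite /geometric/= exprS invfM mulrA -exprVn ler_wpM2r// ?exprn_ge0// ?invr_ge0 ?(ltW q0)//.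
  by rewrite ler_wpM2r// ?invr_ge0 ?(ltW q0)// ler_nat.
- apply: is_cvg_geometric_series; rewrite ger0_norm ?invr_ge0 ?(ltW q0)//.
  by rewrite invf_lt1.
Qed.

(** The excess of a remainder over [b / (q - 1)] is multiplied by at least [q] at each step, while
    [codes] keeps it bounded. *)
Lemma rest_le {R : realType} (q : R) (m b : nat) x c n : 1 < q -> codes q m x c ->
  (forall k, (c k <= b)%N) -> rest q x c n <= b%:R / (q - 1).
Proof.
move=> q1 [_ cM] cb; rewrite -subr_le0.
have bE : b%:R / (q - 1) * (q - 1) = b%:R by rewrite divfK//; lra.
have := @expanding_le0 _ q (m%:R / (q - 1) - b%:R / (q - 1))
  (fun k => rest q x c (n + k) - b%:R / (q - 1)) q1.
rewrite addn0; apply => k; last by have := cM (n + k)%N; lra.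
rewrite addnS /=; have : (c (n + k)%N)%:R <= b%:R :> R by rewrite ler_nat.
nra.
Qed.

(** Reflecting the digits exchanges upper and lower bounds, as well as the two halves of
    [strict_codes]. *)
Lemma codes_compl {R : realType} (q : R) (m : nat) x c : 1 < q -> codes q m x c ->
  codes q m (m%:R / (q - 1) - x) (fun k => (m - c k)%N) /\
  forall n, rest q (m%:R / (q - 1) - x) (fun k => (m - c k)%N) n
            = m%:R / (q - 1) - rest q x c n.
Proof.
move=> q1 [cm cM].
have mE : m%:R / (q - 1) * (q - 1) = m%:R by rewrite divfK//; lra.
have rE n : rest q (m%:R / (q - 1) - x) (fun k => (m - c k)%N) n
            = m%:R / (q - 1) - rest q x c n.
  by elim: n => //= n ->; rewrite natrB//; lra.
split => //; split => [k|n]; first exact: leq_subr.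
by rewrite rE; have := cM n; lra.
Qed.

Lemma rest_ge {R : realType} (q : R) (m a : nat) x c n : 1 < q -> codes q m x c ->
  (forall k, (a <= c k)%N) -> a%:R / (q - 1) <= rest q x c n.
Proof.
move=> q1 xc ac; have [cx rE] := codes_compl q1 xc; have [cm _] := xc.
have := rest_le n (b := (m - a)%N) q1 cx; rewrite rE natrB ?(leq_trans (ac 0%N))// mulrBl.
by rewrite lerD2l lerN2; apply => k; exact: leq_sub2l.
Qed.

(** With equal digits, the [q']-remainder minus the [q]-remainder expands, which gives the lower
    bound. For the upper one, [B * (q - 1) = (q' - q) * M'] is exactly what makes the excess over
    [B] expand. *)
Lemma codes_base {R : realType} (q q' : R) (m : nat) x x' c : 1 < q -> q <= q' ->
  codes q m x c -> codes q' m x' c ->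
  0 <= x - x' <= (q' - q) * (m%:R / (q' - 1) / (q - 1)).
Proof.
move=> q1 qq' [_ xc] [_ xc'].
set M' := m%:R / (q' - 1) in xc' *; set M := m%:R / (q - 1) in xc.
set B := (q' - q) * _.
have BE : B * (q - 1) = (q' - q) * M' by rewrite /B -mulrA divfK//; lra.
apply/andP; split.
  rewrite subr_ge0 -subr_le0.
  apply: (@expanding_le0 _ q M' (fun n => rest q' x' c n - rest q x c n)) => //= n;
    have := xc n; have := xc' n; first nra.
  by lra.
rewrite -subr_le0.
apply: (@expanding_le0 _ q (M - B) (fun n => rest q x c n - rest q' x' c n - B)) => //= n;
  have := xc n; have := xc' n; first nra.
by lra.
Qed.

(** By [codes_base] on the tails of [c] and of its reflection, neither the remainders nor their
    complements increase with the base, so their upper bounds 1 persist. *)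
Lemma strict_codes_base {R : realType} (q q' : R) (m : nat) x x' c : 1 < q -> q <= q' ->
  strict_codes q m x c -> codes q' m x' c -> strict_codes q' m x' c.
Proof.
move=> q1 qq' [xc cs] xc'; split => // n; have [c1 c2] := cs n.
have q'1 : 1 < q' by lra.
have h1 := codes_base q1 qq' (codes_shift n.+1 xc) (codes_shift n.+1 xc').
have [ux uE] := codes_compl q1 xc; have [ux' uE'] := codes_compl q'1 xc'.
have := codes_base q1 qq' (codes_shift n.+1 ux) (codes_shift n.+1 ux').
rewrite uE uE' => h2.
by split=> [/c1|/c2]; lra.
Qed.

(** * Holes and null slices *)

Lemma continuous_rest {R : realType} c n : continuous (fun p : R * R => rest p.2 p.1 c n).
Proof.
elim: n => [|n IH] p /=; first exact: cvg_fst.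
by apply: cvgB; [apply: cvgM; [exact: cvg_snd|exact: IH]|exact: cvg_cst].
Qed.

Lemma near_snd {R : realType} (p : R * R) a b : a < p.2 < b ->
  \forall s \near p, a < s.2 < b.
Proof.
move=> /andP[ap pb].
have snd_cvg : snd s @[s --> p] --> p.2 by exact: cvg_snd.
near=> s; apply/andP; split; near: s.
  exact: (cvgr_gt _ snd_cvg _ ap).
exact: (cvgr_lt _ snd_cvg _ pb).
Unshelve. all: by end_near.
Qed.

(** After the first [n] digits of [c], both 0 and 1 leave an admissible remainder, which contradicts
    [Uset_prefix]. *)
Lemma hole_Uset {R : realType} (q z : R) (m : nat) c n : 1 < q -> m%:R < q <= m.+1%:R ->
  (forall k, (c k <= m)%N) -> 1 < q * rest q z c n < m%:R / (q - 1) -> ~ Uset (z, q).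
Proof.
move=> q1 mqm cm /andP[r1 rM] Uz.
have m1 : (0 < m)%N.
  by have /andP[_] := mqm; case: (m) => //; lra.
pose e (j : nat) k := if k == n then j else c k.
have em j k : (j <= 1)%N -> (e j k <= m)%N.
  by rewrite /e; case: ifP => // _ j1; apply: leq_trans m1.
have eE j : rest q z (e j) n.+1 = q * rest q z c n - j%:R.
  rewrite /= {2}/e eqxx (@eq_rest _ q z (e j) c n)// => k kn.
  by rewrite /e; case: eqP => // kE; rewrite kE ltnn in kn.
have : e 0%N n = e 1%N n.
  apply: (Uset_prefix (n := n.+1) q1 mqm Uz) => //.
  - by move=> k _; exact: em.
  - by move=> k _; exact: em.
  - by rewrite eE; lra.
  - by rewrite eE; lra.
by rewrite /e eqxx.
Qed.

Lemma hole_closure {R : realType} (q z : R) (m : nat) c n : 1 < q -> m%:R < q < m.+1%:R ->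
  (forall k, (c k <= m)%N) -> 1 < q * rest q z c n < m%:R / (q - 1) ->
  ~ closure Uset (z, q).
Proof.
move=> q1 mqm cm /andP[r1 rM] clz.
have cr : (s.2 * rest s.2 s.1 c n) @[s --> (z, q)] --> q * rest q z c n.
  apply: cvgM; first exact: cvg_snd.
  exact: (@continuous_rest R c n (z, q)).
(* The upper inequality is multiplied out by [s.2 - 1], so that its continuity involves no
   division. *)
have cr' : (s.2 * rest s.2 s.1 c n * (s.2 - 1)) @[s --> (z, q)] -->
    q * rest q z c n * (q - 1).
  apply: cvgM => //; apply: cvgB; [exact: cvg_snd|exact: cvg_cst].
have rM' : q * rest q z c n * (q - 1) < m%:R by rewrite -ltr_pdivlMr//; lra.
have [] := clz [set s : R * R | (m%:R < s.2 < m.+1%:R /\ 1 < s.2 < q + 1) /\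
  1 < s.2 * rest s.2 s.1 c n < m%:R / (s.2 - 1)].
  near=> s => /=.
  have sq : 1 < s.2 < q + 1 by near: s; apply: near_snd; rewrite /=; lra.
  split; first by split => //; near: s; exact: near_snd.
  apply/andP; split; first by near: s; exact: (cvgr_gt _ cr _ r1).
  rewrite ltr_pdivlMr; last by lra.
  by near: s; exact: (cvgr_lt _ cr' _ rM').
move=> [y r] [Uy /= [[h1 h2] h3]].
apply: (@hole_Uset R r y m c n _ _ cm h3 Uy); lra.
Unshelve. all: by end_near.
Qed.

(** Weak inequalities survive the limit. This provides each point of a slice of the closure with
    greedy digits, along which [slice_null] looks for holes. *)
Lemma closure_range {R : realType} (q x : R) (m : nat) : 1 < q -> m%:R < q < m.+1%:R ->
  closure Uset (x, q) -> 0 <= x <= m%:R / (q - 1).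
Proof.
move=> q1 mqm clx.
have key (B : set (R * R)) : nbhs (x, q) B ->
    exists y r : R, [/\ B (y, r), 1 < r & 0 <= y <= m%:R / (r - 1)].
  move=> nB; have [|[y r] [Uy /= [h1 h2 By]]] :=
    clx [set s | [/\ m%:R < s.2 < m.+1%:R, 1 < s.2 < q + 1 & B s]].
    near=> s => /=; split; near: s => //; apply: near_snd => /=; lra.
  exists y, r; split => //; first by lra.
  have [|||c [[_ yM] _]] := @Uset_strict R r m y => //; try lra.
  exact: (yM 0%N).
have c1 : s.1 @[s --> (x, q)] --> x by exact: cvg_fst.
have c2 : (s.1 * (s.2 - 1)) @[s --> (x, q)] --> x * (q - 1).
  apply: cvgM => //; apply: cvgB; [exact: cvg_snd|exact: cvg_cst].
apply/andP; split; rewrite leNgt; apply/negP => h.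
  have [y [r [/= y0 _]]] := key [set s | s.1 < 0] (cvgr_lt _ c1 _ h).
  by lra.
rewrite ltr_pdivrMr in h; last by lra.
have [y [r [/= y0 r1]]] := key [set s | m%:R < s.1 * (s.2 - 1)] (cvgr_gt _ c2 _ h).
rewrite ler_pdivlMr; lra.
Unshelve. all: by end_near.
Qed.

Lemma closure_base_ge1 {R : realType} (p : R * R) : closure Uset p -> 1 <= p.2.
Proof.
move=> clp; rewrite leNgt; apply/negP => p1.
have [|s [[s1 _] /= s2]] := clp [set s | p.2 - 1 < s.2 < 1].
  by apply: near_snd; lra.
by lra.
Qed.

Lemma closed_slice {R : realType} (C : set (R * R)) q : closed C -> closed [set x | C (x, q)].
Proof.
move=> cC; apply: (preimage_closed (f := fun x : R => (x, q)) _ cC) => x _.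
exact: (cvg_pair (cvg_id (F := nbhs x)) (cvg_cst q)).
Qed.

(* Around each of its points the slice misses, at every scale [q ^- n], an open
   interval of comparable length, so no point is a density point. *)
Lemma slice_null {R : realType} (q : R) (m : nat) : 1 < q -> m%:R < q < m.+1%:R ->
  lebesgue_measure [set x : R | closure Uset (x, q)] = 0%E.
Proof.
move=> q1 mqm; set S := [set x | _].
set M := m%:R / (q - 1).
have ME : M * (q - 1) = m%:R by rewrite divfK//; lra.
have M1 : 1 < M by rewrite ltr_pdivlMr; rewrite -natr1 in mqm; lra.
have cS : closed S by apply: closed_slice; exact: closed_closure.
have mS : measurable S by exact: closed_measurable.
apply: measure_negligible => //.
apply: negligibleS (lebesgue_density mS) => x Sx /= dens.
(* The ratio of the hole length [(M - 1) / q / q ^+ n] to the diameter [2 * M / q ^+ n] of the ball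
   used below; it does not depend on [n]. *)
pose k := (M - 1) / (q * (M *+ 2)).
have k0 : 0 < k by rewrite divr_gt0 ?mulr_gt0 ?mulrn_wgt0//; lra.
have /dens : nbhs (\1_S x)%:E [set y : \bar R | ((1 - k)%:E < y)%E].
  apply: open_nbhs_nbhs; split; first exact: open_ereal_gt_ereal.
  by rewrite /= indicE mem_set// lte_fin /=; lra.
move=> [d /= d0 dP].
have [n nd] := expr_unbounded (M / d) q1.
have qn0 : 0 < q ^+ n by rewrite exprn_gt0//; lra.
set r := M / q ^+ n.
have r0 : 0 < r by rewrite divr_gt0//; lra.
have rd : r < d by rewrite ltr_pdivrMr// mulrC -ltr_pdivrMr.
have := dP r; rewrite /ball_ /= sub0r normrN gtr0_norm// => /(_ rd r0).
apply/negP; rewrite -leNgt.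
have [c [cm cM]] : exists c, codes q m x c.
  by apply: greedy => //; [lra|exact: closure_range].
(* The remainder is affine in the point, with slope [q ^+ n]; [a] and [b] are where it takes the
   values [1 / q] and [M / q]. *)
pose a := x + (q^-1 - rest q x c n) / q ^+ n.
pose b := x + (M / q - rest q x c n) / q ^+ n.
have ab : a < b.
  rewrite ltrD2l ltr_pM2r ?invr_gt0// ltrD2r -[X in X < _]mul1r ltr_pM2r// invr_gt0; lra.
have baE : b - a = k * (r *+ 2).
  rewrite /b /a /k /r; field.
  by apply/and3P; split; lra.
have inH z : z \in `]a, b[ -> 1 < q * rest q z c n < M.
  have -> : rest q z c n = rest q x c n + q ^+ n * (z - x) by rewrite -(rest_sub q z x c n); lra.
  rewrite in_itv/= /a /b -ltrBrDl ltr_pdivrMr// -ltrBlDl ltr_pdivlMr// => /andP[h1 h2].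
  have qV : q * q^-1 = 1 by rewrite mulfV//; lra.
  have qM : q * (M / q) = M by rewrite mulrC divfK//; lra.
  have q0 : 0 < q by lra.
  rewrite [q ^+ n * _]mulrC; apply/andP; split.
    by rewrite -[ltLHS]qV ltr_pM2l//; lra.
  by rewrite -[ltRHS]qM ltr_pM2l//; lra.
have HB : `]a, b[%classic `<=` ball x r.
  move=> z /=; rewrite in_itv/= => /andP[az zb]; rewrite /ball/= ltr_norml.
  have qV0 : 0 < q^-1 by rewrite invr_gt0; lra.
  have qM : M / q < M by rewrite ltr_pdivrMr; nra.
  have := cM n; rewrite -/M => /andP[c0 c1].
  have ra : x - r < a by rewrite /a /r -mulNr ltrD2l ltr_pM2r ?invr_gt0//; lra.
  have br : b < x + r by rewrite /b /r ltrD2l ltr_pM2r ?invr_gt0//; lra.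
  by apply/andP; split; lra.
have SB : S `&` ball x r `<=` ball x r `\` `]a, b[%classic.
  move=> z [Sz Bz]; split => // /inH h.
  by apply: (@hole_closure R q z m c n) => //.
have mB : measurable (ball x r) by exact: measurable_ball.
have mSB : (lebesgue_measure (S `&` ball x r) <= ((1 - k) * (r *+ 2))%:E)%E.
  apply: (@le_trans _ _ (lebesgue_measure (ball x r `\` `]a, b[%classic))).
    by apply: le_measure => //; rewrite inE; [exact: measurableI|exact: measurableD].
  rewrite measureD//=; last by rewrite lebesgue_measure_ball ?ltry// ltW.
  rewrite (setIidr HB) lebesgue_measure_ball ?(ltW r0)// lebesgue_measure_itv/= lte_fin ab.
  by rewrite -!EFinB baE lee_fin; lra.
rewrite lebesgue_measure_ball ?(ltW r0)// inver mulrn_eq0/= gt_eqF//.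
apply: le_trans (lee_wpmul2r _ mSB) _; first by rewrite lee_fin invr_ge0 mulrn_wge0// ltW.
by rewrite -EFinM mulfK// mulrn_eq0/= gt_eqF.
Qed.

(** * Topology and measure of the closure *)

(** Measurability refers to the product sigma-algebra, so an open set is written as a countable
    union of boxes with rational centres and radii [1 / (k + 1)]. *)
Lemma open_measurable_plane {R : realType} (O : set (R * R)) : open O -> measurable O.
Proof.
move=> oO.
pose box (a b : rat) (k : nat) : set (R * R) :=
  ball (ratr a : R) k.+1%:R^-1 `*` ball (ratr b : R) k.+1%:R^-1.
have -> : O = \bigcup_(a : rat) \bigcup_(b : rat) \bigcup_(k : nat)
    (if `[< box a b k `<=` O >] then box a b k else set0).
  apply/seteqP; split => [[x y] Oxy|p [a _ [b _ [k _]]]]; last first.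
    by case: asboolP => // h /h.
  have /nbhs_ballP[e /= e0 eO] : nbhs (x, y) O by exact: open_nbhs_nbhs.
  have [k _ ke] := near_infty_natSinv_lt (PosNum (divr_gt0 e0 (ltr0n R 2))).
  have {}ke : k.+1%:R^-1 < e / 2 by have := ke k (leqnn k).
  have inball (u v : R) : v - k.+1%:R^-1 < u < v -> ball u k.+1%:R^-1 v.
    have : 0 < k.+1%:R^-1 :> R by [].
    by move: k.+1%:R^-1 => r r0; rewrite /ball/= ltr_norml; lra.
  have ball_near (u v w : R) : v - k.+1%:R^-1 < u < v -> ball u k.+1%:R^-1 w -> ball v e w.
    by move: k.+1%:R^-1 ke => r re; rewrite /ball/= !ltr_norml; lra.
  have k0 : 0 < k.+1%:R^-1 :> R by [].
  have [|a] := @rat_in_itvoo R (x - k.+1%:R^-1) x; first by rewrite ltrBlDr ltrDl.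
  rewrite in_itv/= => ax.
  have [|b] := @rat_in_itvoo R (y - k.+1%:R^-1) y; first by rewrite ltrBlDr ltrDl.
  rewrite in_itv/= => yb.
  exists a => //; exists b => //; exists k => //; case: asboolP => [_|].
    by split; exact: inball.
  case=> -[u v] [/= au bv]; by apply: eO; split; [exact: ball_near ax au|exact: ball_near yb bv].
apply: bigcupT_measurable_rat => a; apply: bigcupT_measurable_rat => b.
apply: bigcupT_measurable => k; case: asboolP => // _.
by apply: measurableX; exact: measurable_ball.
Qed.

Lemma closed_measurable_plane {R : realType} (C : set (R * R)) : closed C -> measurable C.
Proof.
by move=> cC; rewrite -(setCK C); apply: measurableC;
  apply: open_measurable_plane; exact: closed_openC.
Qed.

Lemma countable_rangeT {T : countType} {U : Type} (f : T -> U) : countable (range f).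
Proof. by apply: (sub_countable (card_image_le _ _)); exact: countableP. Qed.

Lemma irrational_in_itv {R : realType} (a b : R) : a < b ->
  exists2 x : R, a < x < b & ~ rational x.
Proof.
move=> ab; apply: contrapT => h.
have : (lebesgue_measure `]a, b[%classic <= lebesgue_measure (@rational R))%E.
  apply: le_measure; rewrite ?inE.
  - exact: measurable_itv.
  - by apply: countable_measurable => [t|]; [exact: measurable_set1|exact: countable_rangeT].
  - move=> x /=; rewrite in_itv/= => xab; apply: contrapT => rx; apply: h; exists x => //.
rewrite lebesgue_measure_itv/= lte_fin ab countable_lebesgue_measure0//.
  by rewrite -EFinB lee_fin; lra.
exact: countable_rangeT.
Qed.

Lemma closure_slice_null {R : realType} (q : R) : (forall n : nat, q != n%:R) ->
  lebesgue_measure [set x : R | closure Uset (x, q)] = 0%E.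
Proof.
move=> qN; have [q1|q1] := ltP 1 q.
  apply: (@slice_null R q (Num.truncn q)) => //.
  have /andP[h1 h2] : (Num.truncn q)%:R <= q < (Num.truncn q).+1%:R.
    by apply: truncn_itv; lra.
  by rewrite h2 lt_neqAle h1 eq_sym qN.
rewrite (_ : [set x | _] = set0) ?measure0//; apply/seteqP; split => // x /=.
move=> /closure_base_ge1 /= q1'; have := qN 1%N.
by rewrite eq_le q1 q1'.
Qed.

Lemma closure_Uset_negligible {R : realType} : (@lebesgue2 R).-negligible (closure Uset).
Proof.
set C : set (R * R) := closure Uset.
have mC : measurable C by apply: closed_measurable_plane; exact: closed_closure.
exists C; split => //.
(* Uniqueness of the product measure allows integrating the slices at fixed base rather than those
   at fixed [x]. *)
have -> : lebesgue2 C = (@lebesgue_measure R \x^ @lebesgue_measure R)%E C.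
  by apply: product_measure_unique => // A B mA mB; exact: product_measure2E.
rewrite /product_measure2 -(integral0 (@lebesgue_measure R) [set: R]).
apply: ge0_ae_eq_integral => //.
- exact: measurable_fun_ysection.
- have N : (@lebesgue_measure R).-negligible (range (fun n : nat => n%:R : R)).
    exists (range (fun n : nat => n%:R : R)); split => //.
      by apply: countable_measurable => [t|]; [exact: measurable_set1|exact: countable_rangeT].
    by apply: countable_lebesgue_measure0; exact: countable_rangeT.
  rewrite /ae_eq /almost_everywhere/=; apply: negligibleS N => q /= h.
  apply: contrapT => qN; apply: h => _.
  rewrite -(@closure_slice_null R q).
    by congr (lebesgue_measure _); apply/seteqP; split => x /=;
      rewrite /ysection/= inE.
  by move=> n; apply/negP => /eqP qn; apply: qN; exists n.
Qed.

(** A box inside the closure would meet some irrational base in a whole interval, but that slice is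
    null. *)
Lemma interior_closure_Uset {R : realType} : interior (closure (@Uset R)) = set0.
Proof.
apply/seteqP; split => // -[x q] /nbhs_ballP[e /= e0 eU].
have [r qr rN] : exists2 r : R, q < r < q + e & forall n : nat, r != n%:R.
  have [|r qr rN] := @irrational_in_itv R q (q + e); first by rewrite ltrDl.
  by exists r => // n; apply/negP => /eqP rn; apply: rN; exists n%:R; rewrite ?ratr_nat.
have := closure_slice_null rN.
apply/eqP; rewrite gt_eqF//.
apply: (@lt_le_trans _ _ (lebesgue_measure (ball x e))).
  by rewrite lebesgue_measure_ball ?(ltW e0)// lte_fin mulrn_wgt0.
apply: le_measure; rewrite ?inE.
- exact: measurable_ball.
- by apply: closed_measurable; apply: closed_slice; exact: closed_closure.
- by move=> y xy; apply: eU; split => //=; rewrite /ball/= ltr_norml; lra.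
Qed.

Lemma Uset_zero {R : realType} (q : R) : 1 < q -> Uset (0, q).
Proof.
move=> q1; have [m mqm] := base_digits q1.
have r0 n : rest q 0 (fun=> 0%N) n = 0 by elim: n => //= n ->; rewrite mulr0 subr0.
apply: (strict_Uset (c := fun=> 0%N) q1 mqm); split => [|n].
  by split => // n; rewrite r0 lexx divr_ge0//; lra.
by rewrite r0.
Qed.

(** The missing limit point is [(0, 1)], approached by the points [(0, q)]. *)
Lemma Uset_not_closed {R : realType} : ~ closed (@Uset R).
Proof.
move=> /closure_id UE; suff : Uset (0 : R, 1 : R) by case; rewrite /= ltxx.
rewrite UE => B /nbhs_ballP[e /= e0 eB].
exists (0, 1 + e / 2); split; first by apply: Uset_zero; lra.
by apply: eB; split; rewrite /ball/= ltr_norml; lra.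
Qed.

Definition near_point {R : realType} (p : R * R) (e : R) (s : R * R) :=
  `|p.1 - s.1| < e /\ `|p.2 - s.2| < e.

Lemma rational_rest {R : realType} (n0 : nat) (x : R) c n :
  rational (rest n0.+1%:R x c n) -> rational x.
Proof.
elim: n => //= n IH [a _ aE]; apply: IH.
exists ((a + (c n)%:R) / n0.+1%:R) => //.
by rewrite fmorph_div rmorphD/= !ratr_nat aE subrK mulrC mulKf// pnatr_eq0.
Qed.

(* In an integer base a remainder can only violate the strict inequalities by
   being [0] or [1], which makes [x] rational. *)
Lemma irrational_Uset {R : realType} (m : nat) (x : R) : (0 < m)%N -> 0 <= x <= 1 ->
  ~ rational x -> Uset (x, m.+1%:R).
Proof.
move=> m0 x01 irx.
have m1R : 1 <= m%:R :> R by rewrite ler1n.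
have q1 : 1 < m.+1%:R :> R by rewrite ltr1n.
have mqm : m%:R < (m.+1%:R : R) <= m.+1%:R.
  by apply/andP; split; [rewrite ltr_nat|exact: lexx].
have M1 : m%:R / (m.+1%:R - 1) = 1 :> R.
  by rewrite -natr1 addrK divff// pnatr_eq0 -lt0n.
have [c xc] : exists c, codes m.+1%:R m x c by apply: greedy => //; rewrite M1.
apply: (strict_Uset (c := c) q1 mqm); split => // n.
have [_ /(_ n.+1)] := xc; rewrite M1 => /andP[r0 r1].
have [r0'|r0'] := eqVneq (rest m.+1%:R x c n.+1) 0.
  by case: irx; apply: (@rational_rest R m x c n.+1); rewrite r0'; exists 0; rewrite ?rmorph0.
have [r1'|r1'] := eqVneq (rest m.+1%:R x c n.+1) 1.
  by case: irx; apply: (@rational_rest R m x c n.+1); rewrite r1'; exists 1; rewrite ?rmorph1.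
have := conj r0' r1'; rewrite !neq_lt; lra.
Qed.

Lemma Uset_nearby_point {R : realType} (p : R * R) (e : R) : Uset p -> 0 < e ->
  exists s, [/\ Uset s, s <> p & near_point p e s].
Proof.
case: p => x q Up e0; have q1 : 1 < q by have [] := Up.
have [m mqm] := base_digits q1.
have [c [xc cs]] := Uset_strict q1 mqm Up.
set M := m%:R / (q - 1) in xc cs.
have M0 : 0 <= M by rewrite divr_ge0//; lra.
have [qE|qN] := eqVneq q m.+1%:R.
  have M1 : M = 1.
    rewrite /M qE -natr1 addrK divff// pnatr_eq0; apply/eqP => m0.
    by rewrite qE m0 ltxx in q1.
  have [_ /(_ 0%N)] := xc; rewrite -/M M1 /= => x01.
  have m0 : (0 < m)%N by rewrite -(ltr_nat R) -(ltrD2r 1) add0r natr1 -qE.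
  suff [y [y01 yx iry ye]] : exists y, [/\ 0 <= y <= 1, y != x, ~ rational y & `|x - y| < e].
    exists (y, q); split; first by rewrite qE; exact: irrational_Uset.
      by case=> yE; rewrite yE eqxx in yx.
    by split => //=; rewrite subrr normr0.
  have [x1|x1] := ltP x 1.
    have [|y] := @irrational_in_itv R x (Num.min 1 (x + e)).
      by rewrite lt_min x1 ltrDl.
    rewrite lt_min => /and3P[xy y1 ye] iry; exists y; split => //.
    - by apply/andP; split; lra.
    - by rewrite gt_eqF.
    - by rewrite ltr_norml; lra.
  have [|y] := @irrational_in_itv R (Num.max 0 (1 - e)) 1.
    by rewrite gt_max ltr01 ltrBlDr ltrDl.
  rewrite gt_max => /andP[/andP[y0 ye] y1] iry; exists y; split => //.
  - by apply/andP; split; lra.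
  - by rewrite lt_eqF//; lra.
  - by rewrite ltr_norml; lra.
have qm : q < m.+1%:R by rewrite lt_neqAle qN; have /andP[] := mqm.
pose B := M / (q - 1).
have B0 : 0 <= B by rewrite divr_ge0//; lra.
(* The first bound keeps the digit range [m]. By [codes_base], [x] moves by at most [d * B], so the
   second keeps both moves within [e / 2]. *)
pose d := Num.min (m.+1%:R - q) (e / 2 / (1 + B)).
have d0 : 0 < d by rewrite lt_min subr_gt0 qm !divr_gt0//; lra.
have dm : d <= m.+1%:R - q by rewrite ge_min lexx.
have dB : d * (1 + B) <= e / 2 by rewrite -ler_pdivlMr ?ge_min ?lexx ?orbT//; lra.
have mqm' : m%:R < q + d <= m.+1%:R by lra.
have q'1 : 1 < q + d by lra.
have [cm _] := xc.
have [y yc] := codes_exists q'1 mqm' cm.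
exists (y, q + d); split.
- apply: (strict_Uset (c := c) q'1 mqm').
  by apply: (@strict_codes_base R q _ m x) => //; lra.
- by case=> _; lra.
- have := codes_base q1 _ xc yc; rewrite lerDl (ltW d0) => /(_ isT).
  have BM : m%:R / (q + d - 1) / (q - 1) <= B.
    rewrite ler_pM2r ?invr_gt0; last by lra.
    by apply: ler_wpM2l => //; rewrite lef_pV2 ?posrE; lra.
  have -> : q + d - q = d by rewrite addrAC subrr add0r.
  have := ler_wpM2l (ltW d0) BM.
  move: (m%:R / _ / _) => K h1 h2.
  by split; rewrite /= ltr_norml; apply/andP; split; nra.
Qed.

(** Since [Uset] is dense in its closure, an isolated point of the closure would lie in [Uset]
    itself, where [Uset_nearby_point] applies. *)
Lemma closure_Uset_no_isolated {R : realType} (p : R * R) : ~ isolated (closure Uset) p.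
Proof.
move=> [/set_mem clp [V nV /seteqP[VU _]]].
have [e /= e0 eV] := (nbhs_ballP p V).1 nV.
have inV s : Uset s -> near_point p e s -> s = p.
  move=> Us [n1 n2]; apply: VU; split; last exact: subset_closure.
  by apply: eV; split.
have [s [Us sB]] := clp _ nV.
have sp : s = p by apply: VU; split => //; exact: subset_closure.
rewrite sp in Us.
by have [t [Ut tp /(inV _ Ut)]] := Uset_nearby_point Us e0.
Qed.

(** * Hausdorff dimension: upper bound *)

Lemma diam2_ge0 {R : realType} (A : set (R * R)) : (0%:E <= diam2 A)%E.
Proof. by apply: ereal_sup_ubound; left. Qed.

Lemma diam2_le {R : realType} (A : set (R * R)) (D : R) : 0 <= D ->
  (forall p p', A p -> A p' -> edist2 p p' <= D) -> (diam2 A <= D%:E)%E.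
Proof.
move=> D0 AD; apply: ge_ereal_sup => _ [->|[p Ap [p' Ap' <-]]]; rewrite lee_fin//.
exact: AD.
Qed.

Lemma diam2_set0 {R : realType} : diam2 (@set0 (R * R)) = 0%:E.
Proof. by apply/eqP; rewrite eq_le diam2_ge0 andbT; apply: diam2_le. Qed.

(** The bound by [d] makes the diameter finite; [fine] would send an infinite one to 0. *)
Lemma diam2_edist {R : realType} (A : set (R * R)) (d : R) p p' : (diam2 A <= d%:E)%E ->
  A p -> A p' -> edist2 p p' <= fine (diam2 A) <= d.
Proof.
move=> Ad Ap Ap'; have fA : diam2 A \is a fin_num.
  by rewrite fin_numE; have := diam2_ge0 A; case: (diam2 A) Ad.
rewrite -!lee_fin fineK// Ad andbT.
by apply: ereal_sup_ubound; right; exists p => //; exists p'.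
Qed.

Lemma fine_diam2 {R : realType} (A : set (R * R)) (d : R) : (diam2 A <= d%:E)%E ->
  0 <= fine (diam2 A) <= d.
Proof.
move=> Ad; have fA : diam2 A \is a fin_num.
  by rewrite fin_numE; have := diam2_ge0 A; case: (diam2 A) Ad.
by rewrite -!lee_fin fineK// Ad diam2_ge0.
Qed.

Lemma edist2_le {R : realType} (p p' : R * R) :
  edist2 p p' <= `|p.1 - p'.1| + `|p.2 - p'.2|.
Proof.
rewrite /edist2; move: (p.1 - p'.1) (p.2 - p'.2) => a b.
have ab : 0 <= `|a| + `|b| by rewrite addr_ge0.
rewrite -[leRHS](ger0_norm ab) -sqrtr_sqr ler_wsqrtr// sqrrD !real_normK ?num_real//.
by rewrite addrAC lerDl mulrn_wge0// mulr_ge0.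
Qed.

Lemma edist2_ge {R : realType} (p p' : R * R) :
  `|p.1 - p'.1| <= edist2 p p' /\ `|p.2 - p'.2| <= edist2 p p'.
Proof.
by split; rewrite /edist2 -sqrtr_sqr ler_wsqrtr// ?lerDl ?lerDr sqr_ge0.
Qed.

Lemma unit_cell_cover {R : realType} (u v s d e : R) : 2 < s -> 0 < d -> 0 < e ->
  exists F : nat -> set (R * R),
  [/\ forall p, u <= p.1 < u + 1 -> v <= p.2 < v + 1 -> exists j, F j p,
      forall j, (diam2 (F j) <= d%:E)%E &
      (\sum_(0 <= j <oo) (powR (fine (diam2 (F j))) s)%:E <= e%:E)%E].
Proof.
move=> s2 d0 e0.
(* A grid of [N * N] squares of diameter at most [2 / N] costs at most [4 * (2 / N) ^ (s - 2)]. The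
   condition [2 / N < h] brings the cost below [e] and the diameters below [d]. *)
pose h := Num.min d (powR (e / 4) (s - 2)^-1).
have h0 : 0 < h by rewrite lt_min d0 powR_gt0// divr_gt0.
pose N := (Num.truncn (2 / h)).+1.
have N0 : 0 < N%:R :> R by rewrite ltr0n.
have Nh : 2 / N%:R < h.
  rewrite ltr_pdivrMr// mulrC -ltr_pdivrMr//; exact: truncnS_gt.
pose F j : set (R * R) := if (j < N * N)%N then
  [set p | 0 <= (p.1 - u) * N%:R - (j %/ N)%:R <= 1 /\
           0 <= (p.2 - v) * N%:R - (j %% N)%:R <= 1] else set0.
have FN j : (diam2 (F j) <= (2 / N%:R)%:E)%E.
  rewrite /F; case: ifP => _; last by rewrite diam2_set0 lee_fin divr_ge0.
  apply: diam2_le => [|[x y] [x' y'] /= [x1 y1] [x2 y2]]; first by rewrite divr_ge0.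
  apply: le_trans (edist2_le _ _) _ => /=.
  rewrite ler_pdivlMr// mulrDl -[N%:R]gtr0_norm// -!normrM.
  have : `|(x - x') * N%:R| <= 1 by rewrite ler_norml; lra.
  have : `|(y - y') * N%:R| <= 1 by rewrite ler_norml; lra.
  lra.
exists F; split.
- move=> [x y] /= xu yv.
  pose i := Num.truncn ((x - u) * N%:R); pose k := Num.truncn ((y - v) * N%:R).
  have /andP[i1 i2] : i%:R <= (x - u) * N%:R < i.+1%:R.
    by apply: truncn_itv; rewrite mulr_ge0//; lra.
  have /andP[k1 k2] : k%:R <= (y - v) * N%:R < k.+1%:R.
    by apply: truncn_itv; rewrite mulr_ge0//; lra.
  have iN : (i < N)%N
    by rewrite -(ltr_nat R); apply: le_lt_trans i1 _; rewrite -[ltRHS]mul1r ltr_pM2r//; lra.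
  have kN : (k < N)%N
    by rewrite -(ltr_nat R); apply: le_lt_trans k1 _; rewrite -[ltRHS]mul1r ltr_pM2r//; lra.
  exists (i * N + k)%N; rewrite /F.
  have -> : (i * N + k < N * N)%N.
    by apply: (@leq_trans (i.+1 * N)); [rewrite mulSn addnC ltn_add2r|rewrite leq_mul2r iN orbT].
  rewrite divnMDl// divn_small// addn0 modnMDl modn_small//=.
  by rewrite -natr1 in i2; rewrite -natr1 in k2; lra.
- move=> j; apply: le_trans (FN j) _; rewrite lee_fin.
  by apply: ltW; apply: lt_le_trans Nh _; rewrite ge_min lexx.
rewrite (nneseries_split 0 (N * N)); last by move=> k _; rewrite lee_fin powR_ge0.
rewrite [X in (_ + X)%E]eseries0; last first.
  move=> j; rewrite add0n => Nj _; rewrite /F ltnNge Nj/= diam2_set0/= powR0//.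
  by rewrite gt_eqF//; lra.
rewrite adde0 add0n sumEFin lee_fin.
apply: (@le_trans _ _ (\sum_(0 <= j < N * N) powR (2 / N%:R) s)).
  apply: ler_sum => j _; have /andP[f0 f1] := fine_diam2 (FN j).
  by apply: ge0_ler_powR; rewrite ?nnegrE ?divr_ge0//; lra.
rewrite sumr_const_nat subn0 -[leLHS]mulr_natr natrM.
have -> : powR (2 / N%:R) s = powR (2 / N%:R) (s - 2) * (2 / N%:R) ^+ 2 :> R.
  rewrite -powR_mulrn ?divr_ge0// -powRD ?subrK//.
  by apply/implyP => _; rewrite gt_eqF// divr_gt0.
have -> : powR (2 / N%:R) (s - 2) * (2 / N%:R) ^+ 2 * (N%:R * N%:R)
    = 4 * powR (2 / N%:R) (s - 2) :> R.
  by rewrite expr2; field; rewrite gt_eqF.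
rewrite mulrC -ler_pdivlMr//.
apply: (@le_trans _ _ (powR (powR (e / 4) (s - 2)^-1) (s - 2))).
  apply: ge0_ler_powR; rewrite ?nnegrE ?powR_ge0 ?divr_ge0//; first by lra.
  by apply: ltW; apply: lt_le_trans Nh _; rewrite ge_min lexx orbT.
by rewrite -powRrM mulVf ?powRr1 ?divr_ge0 ?(ltW e0)//; rewrite gt_eqF//; lra.
Qed.

Lemma plane_cover {R : realType} (s d e : R) : 2 < s -> 0 < d -> 0 < e ->
  exists E : nat -> set (R * R),
  [/\ setT `<=` \bigcup_i E i, forall j, (diam2 (E j) <= d%:E)%E &
      (\sum_(0 <= j <oo) (powR (fine (diam2 (E j))) s)%:E <= e%:E)%E].
Proof.
move=> s2 d0 e0.
(* Unit cells are numbered through their integer corners; a number coding no pair repeats the cell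
   at the origin. Cell [k] gets the budget [e / 2 ^ (k + 1)]. *)
pose corner (k : nat) : int * int := odflt (0, 0) (unpickle k).
have e0' k : 0 < e / (2 ^ k.+1)%:R by rewrite divr_gt0// ltr0n expn_gt0.
have [F FP] := boolp.choice (fun k =>
  unit_cell_cover (corner k).1%:~R (corner k).2%:~R s2 d0 (e0' k)).
have /card_esym/ppcard_eqP[f] := card_nat2.
exists (fun i => F (f i).1 (f i).2); split.
- move=> [x y] _; have [/(_ (x, y))] := FP (pickle (Num.floor x, Num.floor y)).
  rewrite /corner pickleK/= => h _ _.
  have [||j Fj] := h.
  + by rewrite floor_le// -intrD1 floorD1_gt.
  + by rewrite floor_le// -intrD1 floorD1_gt.
  exists (f^-1%FUN (pickle (Num.floor x, Num.floor y), j)) => //=.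
  by rewrite invK ?inE.
- by move=> i; have [_ + _] := FP (f i).1; exact.
have c0 k j : (0%:E <= (powR (fine (diam2 (F k j))) s)%:E)%E by rewrite lee_fin powR_ge0.
rewrite nneseries_esumT//.
rewrite -(reindex_esum setT setT f (fun kj => (powR (fine (diam2 (F kj.1 kj.2))) s)%:E)) //.
have -> : [set: nat * nat] = [set: nat] `*`` (fun=> [set: nat]) by apply/seteqP; split.
rewrite -(@esum_esum _ _ _ _ _ (fun k j => (powR (fine (diam2 (F k j))) s)%:E))//.
apply: le_trans (epsilon_trick0 xpredT (ltW e0)).
rewrite nneseries_esumT; last by move=> k; rewrite lee_fin ltW.
apply: le_esum => k _.
by rewrite -nneseries_esumT//; have [_ _] := FP k.
Qed.

Lemma hausdorff_measure_gt2 {R : realType} (A : set (R * R)) (s : R) : 2 < s ->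
  hausdorff_measure s A = 0%E.
Proof.
move=> s2; apply/eqP; rewrite eq_le; apply/andP; split.
  apply: ge_ereal_sup => _ [d /= d0 <-]; apply/lee_addgt0Pr => e e0; rewrite add0e.
  have [E [EA Ed Ee]] := plane_cover s2 d0 e0.
  apply: le_trans Ee; apply: ereal_inf_lbound; exists E => //=; split => //.
  exact: subset_trans EA.
apply: (@le_trans _ _ (hausdorff_pre s 1 A)); last by apply: ereal_sup_ubound; exists 1 => //=.
apply: le_ereal_inf_tmp => _ [E _ <-]; apply: nneseries_ge0 => n _ _.
by rewrite lee_fin powR_ge0.
Qed.

Lemma hausdorff_dim_le2 {R : realType} (A : set (R * R)) : (hausdorff_dim A <= 2%:E)%E.
Proof.
apply/lee_addgt0Pr => e e0; apply: ereal_inf_lbound; exists (2 + e) => //=.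
split; first by lra.
by apply: hausdorff_measure_gt2; lra.
Qed.

(** * Hausdorff dimension: lower bound *)

(* Avoiding the extreme digits [0] and [b + 1] keeps all remainders and their
   complements below [b / (q - 1)], which is less than [1]. *)
Lemma middle_digits_Uset {R : realType} (b : nat) (q : R) c : (0 < b)%N ->
  b.+1%:R < q <= b.+2%:R -> (forall k, (c k < b)%N) ->
  exists x, [/\ codes q b.+1 x (fun k => (c k).+1), Uset (x, q) &
    forall n, 1 / (q - 1) <= rest q x (fun k => (c k).+1) n <= b%:R / (q - 1)].
Proof.
move=> b0 bqb cb; have b0' : 1 <= b%:R :> R by rewrite ler1n.
have q1 : 1 < q by move: bqb; rewrite -natr1; lra.
have [x xc] : exists x, codes q b.+1 x (fun k => (c k).+1).
  by apply: codes_exists => // k; exact: ltnW (cb k).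
have rb n : 1 / (q - 1) <= rest q x (fun k => (c k).+1) n <= b%:R / (q - 1).
  by rewrite (rest_ge (a := 1) n q1 xc)// (rest_le n q1 xc).
exists x; split => //; apply: (strict_Uset (c := fun k => (c k).+1) q1 bqb).
have bq : b%:R / (q - 1) < 1.
  by rewrite ltr_pdivrMr; move: bqb; rewrite -natr1; lra.
split => // n; have := rb n.+1; rewrite -[b.+1%:R]natr1 mulrDl; split => _; lra.
Qed.

(* The dimension of the set of reals having [b] given digits in base [b + 2]. *)
Definition theta {R : realType} (b : nat) : R := ln b%:R / ln b.+2%:R.

Lemma theta_gt0 {R : realType} (b : nat) : (1 < b)%N -> 0 < theta b :> R.
Proof.
by move=> b1; rewrite divr_gt0// ln_gt0// ltr1n// ltnS ltnW.
Qed.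

Lemma powR_theta {R : realType} (b : nat) : (1 < b)%N -> powR b.+2%:R (theta b) = b%:R :> R.
Proof.
move=> b1; rewrite /powR gt_eqF ?ltr0n// divfK ?lnK ?posrE ?ltr0n ?(ltnW b1)//.
by rewrite gt_eqF// ln_gt0// ltr1n.
Qed.

(* Hölder continuity of the map sending a point of the slice at [q] to the
   number with the same digits, shifted by one, in base [b]. *)
Lemma recode_holder {R : realType} (b : nat) (q t t' x x' : R) c c' : (1 < b)%N ->
  b.+1%:R < q <= b.+2%:R ->
  codes b%:R b.-1 t c -> codes b%:R b.-1 t' c' ->
  codes q b.+1 x (fun k => (c k).+1) -> codes q b.+1 x' (fun k => (c' k).+1) ->
  `|t - t'| <= b%:R ^+ 2 * powR `|x - x'| (theta b).
Proof.
move=> b1 bqb tc tc' xc xc'.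
have b1R : 1 < b%:R :> R by rewrite ltr1n.
have bq : b%:R + 1 < q <= b%:R + 1 + 1 by rewrite !natr1.
have q1 : 1 < q by lra.
have M1 : b.-1%:R / (b%:R - 1) = 1 :> R.
  by rewrite -subn1 natrB ?divff//; [lra|exact: ltnW].
have [|/existsNP[k /eqP ck]] := pselect (forall k, c k = c' k).
  move=> /funext cc'; rewrite -cc' in tc'.
  by rewrite (codes_inj b1R tc tc') subrr normr0 mulr_ge0// powR_ge0.
have exn : exists n, c n != c' n by exists k.
have [n cn nmin] := ex_minnP exn.
have pre j : (j < n)%N -> c j = c' j.
  by move=> jn; apply/eqP/negPn/negP => /nmin; rewrite leqNgt jn.
have tn : b%:R ^+ n * `|t - t'| <= 1.
  rewrite -[b%:R ^+ n]ger0_norm ?exprn_ge0// -normrM -(rest_sub b%:R t t' c n).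
  rewrite (eq_rest b%:R t' pre).
  have [_ /(_ n)] := tc; have [_ /(_ n)] := tc'; rewrite M1 ler_norml; lra.
pose s k := (c k).+1; pose s' k := (c' k).+1.
have digit_le (y : R) (e : nat -> nat) i : (forall j, (e j <= b.-1)%N) ->
    codes q b.+1 y (fun k => (e k).+1) ->
    1 / (q - 1) <= rest q y (fun k => (e k).+1) i <= b%:R / (q - 1).
  move=> eb yc; rewrite (rest_ge (a := 1) i q1 yc)// (rest_le i q1 yc)// => j.
  by rewrite (leq_ltn_trans (eb j))// prednK// ltnW.
have sn : q ^+ n * (x - x') = rest q x s n - rest q x' s' n.
  rewrite -(rest_sub q x x' s n); congr (_ - _); apply: eq_rest => j jn.
  by rewrite /s /s' pre.
(* At the first difference the digits are at least 1 apart, while the following remainders differ by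
   at most [(b - 1) / (q - 1) <= 1 - 1 / b]. A separation of [1 / b] is left. *)
have xn : 1 <= b%:R * (q ^+ n.+1 * `|x - x'|).
  have qn0 : 0 <= q ^+ n.+1 by rewrite exprn_ge0//; lra.
  have -> : q ^+ n.+1 * `|x - x'| = `|q * (rest q x s n - rest q x' s' n)|.
    by rewrite -sn mulrA -exprS normrM (ger0_norm qn0).
  have := digit_le x c n.+1 (proj1 tc) xc; have := digit_le x' c' n.+1 (proj1 tc') xc'.
  rewrite -/s -/s' /=.
  set r := rest q x s n; set r' := rest q x' s' n.
  have gap : b%:R / (q - 1) - 1 / (q - 1) <= 1 - b%:R^-1.
    rewrite -mulrBl ler_pdivrMr; last by lra.
    have bV : b%:R^-1 * b%:R = 1 :> R by rewrite mulVf//; lra.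
    have bV1 : b%:R^-1 < 1 :> R by rewrite invf_lt1; lra.
    move: (b%:R^-1 : R) bV bV1 => v bV bV1.
    apply: (@le_trans _ _ ((1 - v) * b%:R)); first by rewrite mulrBl bV mul1r.
    by apply: ler_wpM2l; lra.
  move=> h1 h2.
  suff : b%:R^-1 <= `|q * (r - r')|.
    by rewrite -[X in X <= _ -> _]mul1r ler_pdivrMr ?[_ * b%:R]mulrC//; lra.
  move: cn; rewrite neq_ltn => /orP[cn|cn].
    have : (c n).+1%:R <= (c' n)%:R :> R by rewrite ler_nat.
    move: h1 h2; rewrite /s /s' -!natr1 => h1 h2 h3.
    by rewrite ler_normr; apply/orP; right; lra.
  have : (c' n).+1%:R <= (c n)%:R :> R by rewrite ler_nat.
  move: h1 h2; rewrite /s /s' -!natr1 => h1 h2 h3.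
  by rewrite ler_normr; apply/orP; left; lra.
have D0 := normr_ge0 (x - x'); set D := `|x - x'| in xn D0 *.
(* Bounding [q] and [b] by [b + 2] prepares for raising to the power [theta b], which turns [b + 2]
   into [b]. *)
have Pn : 1 <= b.+2%:R ^+ n.+2 * D.
  apply: (le_trans xn); rewrite mulrA ler_wpM2r// [leRHS]exprS.
  apply: ler_pM => //; first by rewrite exprn_ge0//; lra.
    by rewrite ler_nat -addn2 leq_addr.
  by rewrite lerXn2r ?nnegrE//; lra.
have Pt : 1 <= b%:R ^+ n.+2 * powR D (theta b).
  have <- : powR (b.+2%:R ^+ n.+2) (theta b) = b%:R ^+ n.+2 :> R.
    by rewrite -powR_mulrn// powRAC powR_theta// powR_mulrn//.
  rewrite -powRM ?exprn_ge0//.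
  suff : powR 1 (theta b) <= powR (b.+2%:R ^+ n.+2 * D) (theta b) by rewrite powR1.
  by apply: ge0_ler_powR; rewrite ?nnegrE ?(ltW (theta_gt0 b1))// mulr_ge0 ?exprn_ge0.
have bn0 : 0 < b%:R ^+ n :> R by rewrite exprn_gt0//; lra.
rewrite -(ler_pM2l bn0); apply: (le_trans tn); apply: (le_trans Pt).
by rewrite mulrA -exprD addn2.
Qed.

(* Mass distribution on one slice, the mass being Lebesgue measure transported
   from [0, 1] by the base [b] recoding. *)
Lemma slice_mass {R : realType} (b : nat) (q : R) (S : nat -> set R) (D : nat -> R) :
  (1 < b)%N -> b.+1%:R < q <= b.+2%:R -> (forall i, 0 <= D i) ->
  (forall i x x', S i x -> S i x' -> `|x - x'| <= D i) ->
  (forall x, Uset (x, q) -> exists i, S i x) ->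
  (1%:E <= \sum_(0 <= i <oo)
    if `[< S i !=set0 >] then (2 * b%:R ^+ 2 * powR (D i) (theta b))%:E else 0)%E.
Proof.
move=> b1 bqb D0 SD Scov.
have b1R : 1 < b%:R :> R by rewrite ltr1n.
have M1 : b.-1%:R / (b%:R - 1) = 1 :> R.
  by rewrite -subn1 natrB ?divff//; [lra|exact: ltnW].
pose T i : set R := [set t | exists c x, [/\ codes b%:R b.-1 t c,
  codes q b.+1 x (fun k => (c k).+1) & S i x]].
pose r i := b%:R ^+ 2 * powR (D i) (theta b).
have r0 i : 0 <= r i by rewrite mulr_ge0 ?exprn_ge0 ?powR_ge0.
have Tr i t t' : T i t -> T i t' -> `|t - t'| <= r i.
  move=> [c [x [tc xc Sx]]] [c' [x' [tc' xc' Sx']]].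
  apply: le_trans (recode_holder b1 bqb tc tc' xc xc') _.
  rewrite ler_wpM2l ?exprn_ge0//; apply: ge0_ler_powR; rewrite ?nnegrE//.
    by rewrite ltW// theta_gt0.
  exact: SD Sx Sx'.
have Tcov t : 0 <= t <= 1 -> exists i, T i t.
  rewrite -M1 => t01; have [|c tc] := greedy b1R _ t01; first by rewrite prednK// ltnW.
  have [cb _] := tc.
  have [k|x [xc Ux _]] := middle_digits_Uset (ltnW b1) bqb (c := c).
    by rewrite -(prednK (ltnW b1)) ltnS.
  by have [i Sx] := Scov x Ux; exists i, c, x.
pose tau i := xget 0 (T i).
(* [T i] is enclosed in an interval about one of its points, so its own measurability is not at
   issue; the length [2 * r i] explains the factor 2. *)
pose A i : set R := if `[< T i !=set0 >] then `[tau i - r i, tau i + r i]%classic else set0.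
have mA i : measurable (A i) by rewrite /A; case: asboolP.
have AT i t : T i t -> A i t.
  move=> Tt; rewrite /A; case: asboolP => [_|]; last by case; exists t.
  have Ttau : T i (tau i) by apply: xgetPex; exists t.
  by have := Tr _ _ _ Tt Ttau; rewrite /= in_itv/= ler_norml; lra.
apply: (@le_trans _ _ (lebesgue_measure `[0 : R, 1]%classic)).
  by rewrite lebesgue_measure_itv/= lte_fin ltr01 sube0.
apply: (@le_trans _ _ (\sum_(0 <= i <oo) lebesgue_measure (A i))%E).
  apply: measure_sigma_subadditive => //.
  by move=> t /=; rewrite in_itv/= => /Tcov[i /AT]; exists i.
apply: lee_nneseries => // i _; rewrite /A; case: asboolP => [[t [c [x [_ _ Sx]]]]|_].
  have -> : `[< S i !=set0 >] by apply/asboolP; exists x.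
  rewrite lebesgue_measure_itv/= lte_fin; case: ifP => _.
    by rewrite -EFinB lee_fin -/(r i) -mulrA -/(r i); lra.
  by rewrite lee_fin -mulrA mulr_ge0//; exact: r0.
by rewrite measure0; case: ifP => // _; rewrite lee_fin -mulrA mulr_ge0//; exact: r0.
Qed.

Lemma theta_large {R : realType} (s : R) : s < 2 -> exists2 b, (1 < b)%N & s <= theta b + 1.
Proof.
(* This [b] gives [ln 2 <= (2 - s) * ln b]. Together with [b + 2 <= 2 * b] it yields
   [(s - 1) * ln (b + 2) <= ln b] when [1 < s]. *)
move=> s2; pose b := (Num.truncn (expR (ln 2 / (2 - s)) : R)).+2; exists b => //.
have th0 : 0 < theta b :> R by exact: theta_gt0.
have [s1|s1] := leP s 1; first by lra.
have b0 : 0 < b%:R :> R by rewrite ltr0n.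
have lnb : ln 2 <= (2 - s) * ln b%:R.
  rewrite mulrC -ler_pdivrMr; last by lra.
  rewrite -[leLHS]expRK ler_ln ?posrE ?expR_gt0//.
  by apply: ltW; apply: lt_le_trans (truncnS_gt _) _; rewrite ler_nat.
have ln2 : 0 < ln 2 :> R by rewrite ln_gt0// ltr1n.
have lnb2 : ln b.+2%:R <= ln 2 + ln b%:R :> R.
  rewrite -lnM ?posrE// ler_ln ?posrE ?mulr_gt0 ?ltr0n// -natrM ler_nat /b; lia.
rewrite -lerBlDr /theta ler_pdivlMr; last by rewrite ln_gt0// ltr1n.
nra.
Qed.

(** [slice_mass] is integrated over the unit interval of bases from [b + 1] to [b + 2]. A set of
    diameter [D] meets only bases in an interval of length [2 * D], which supplies the extra factor
    [D]. *)
Lemma hausdorff_pre_ge {R : realType} (b : nat) (s : R) (A : set (R * R)) : (1 < b)%N ->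
  s <= theta b + 1 -> Uset `<=` A ->
  ((4 * b%:R ^+ 2)^-1%:E <= hausdorff_pre s 1 A)%E.
Proof.
move=> b1 sth UA; apply: le_ereal_inf_tmp => _ [E [AE Ed] <-].
pose D i := fine (diam2 (E i)); have D01 i : 0 <= D i <= 1 by exact: fine_diam2.
pose K : R := 2 * b%:R ^+ 2.
have K0 : 0 < K by rewrite mulr_gt0// exprn_gt0// ltr0n ltnW.
have K20 : 0 < 2 * K by exact: mulr_gt0.
pose c i := (xget (0, 0) (E i)).2.
pose J i : set R := `[c i - D i, c i + D i]%classic.
(* [g i] dominates the weight of the slice of [E i] at [q] and is measurable in [q], with no
   measurability asked of [E i]. *)
pose g i q : \bar R := ((K * powR (D i) (theta b))%:E * (\1_(J i) q)%:E)%E.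
have w0 i : 0 <= K * powR (D i) (theta b) by rewrite mulr_ge0 ?powR_ge0// ltW.
have g0 i q : (0 <= g i q)%E by rewrite mule_ge0// lee_fin.
have mg i : measurable_fun [set: R] (g i).
  by apply: emeasurable_funM => //; apply/measurable_EFinP;
    apply: measurable_indic; exact: measurable_itv.
pose I : set R := `]b.+1%:R, b.+2%:R]%classic.
have mI : measurable I by exact: measurable_itv.
have muI : (lebesgue_measure I = 1%:E)%E.
  rewrite lebesgue_measure_itv/= lte_fin ltr_nat ltnSn -EFinB.
  by rewrite -[b.+2%:R]natr1 addrAC subrr add0r.
have slice q : I q -> (1%:E <= \sum_(0 <= i <oo) g i q)%E.
  rewrite /I/= in_itv/= => bqb.
  apply: le_trans (@slice_mass R b q (fun i => [set x | E i (x, q)]) D b1 bqb _ _ _) _.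
  - by move=> i; have /andP[] := D01 i.
  - move=> i x x' /= Ex Ex'; have /andP[+ _] := diam2_edist (Ed i) Ex Ex'.
    by apply: le_trans; have [+ _] := edist2_ge (x, q) (x', q).
  - by move=> x /UA/AE [i _ Ei]; exists i.
  apply: lee_nneseries => [i _ _|i _]; first by case: ifP => // _; rewrite lee_fin; exact: w0.
  case: asboolP => [[x /= Ex]|_]; last exact: g0.
  rewrite /g indicE mem_set ?mule1//.
  have Ec : E i (xget (0, 0) (E i)) by apply: xgetPex; exists (x, q).
  have /andP[h _] := diam2_edist (Ed i) Ex Ec.
  have [_ /= +] := edist2_ge (x, q) (xget (0, 0) (E i)).
  move=> /le_trans /(_ h); rewrite -/(D i) -/(c i) ler_norml /J/= in_itv/=; lra.
have int_g i : (\int[lebesgue_measure]_(q in I) g i q <=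
    (2 * K)%:E * (powR (D i) s)%:E)%E.
  have /andP[Di0 Di1] := D01 i.
  rewrite ge0_integralZl//; first last.
  - by rewrite lee_fin.
  - by apply/measurable_EFinP; apply: measurable_indic; exact: measurable_itv.
  rewrite integral_indic//; last exact: measurable_itv.
  apply: (@le_trans _ _ ((K * powR (D i) (theta b))%:E * (2 * D i)%:E)%E).
    apply: lee_wpmul2l; first by rewrite lee_fin.
    apply: (@le_trans _ _ (lebesgue_measure (J i))).
      apply: le_measure; rewrite ?inE; [|exact: measurable_itv|exact: subIsetl].
      by apply: measurableI => //; exact: measurable_itv.
    rewrite lebesgue_measure_itv/= lte_fin.
    case: ifP => _; rewrite -?EFinB lee_fin; lra.
  rewrite -!EFinM lee_fin.
  have -> : K * powR (D i) (theta b) * (2 * D i) = 2 * K * powR (D i) (theta b + 1).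
    rewrite powRD; last by rewrite gt_eqF// addr_gt0// theta_gt0.
    by rewrite powRr1//; ring.
  rewrite ler_pM2l//.
  have [Dz|Dn0] := eqVneq (D i) 0.
    by rewrite Dz powR0 ?powR_ge0// gt_eqF// addr_gt0// theta_gt0.
  (* Scale 1 in [hausdorff_pre] ensures [D i <= 1], so the smaller exponent [s] gives the larger
     power. *)
  by apply: ger_powR => //; rewrite Di1 lt_neqAle eq_sym Dn0 Di0.
have : (1%:E <= (2 * K)%:E * \sum_(0 <= i <oo) (powR (D i) s)%:E)%E.
  rewrite -nneseriesZl; last by move=> i _; rewrite lee_fin powR_ge0.
  apply: (@le_trans _ _ (\sum_(0 <= i <oo) \int[lebesgue_measure]_(q in I) g i q)%E).
    rewrite -integral_nneseries//; last by move=> i; exact: measurable_funTS (mg i).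
    apply: (@le_trans _ _ (\int[lebesgue_measure]_(q in I) (cst 1%:E q))%E).
      by rewrite integral_cst// mul1e [leRHS]muI.
    apply: ge0_le_integral => //.
    apply: ge0_emeasurable_sum => [i q _ _|i _]; first exact: g0.
    exact: measurable_funTS (mg i).
  apply: lee_nneseries => [i _ _|i _]; last exact: int_g.
  by apply: integral_ge0 => q _; exact: g0.
have -> : (4 * b%:R ^+ 2)^-1 = (2 * K)^-1 :> R by rewrite /K mulrA -natrM.
move=> h; rewrite -(@lee_pmul2l _ (2 * K)%:E)//.
by rewrite -EFinM mulfV// gt_eqF.
Qed.

Lemma hausdorff_dim_ge2 {R : realType} (A : set (R * R)) : Uset `<=` A ->
  (2%:E <= hausdorff_dim A)%E.
Proof.
move=> UA; apply: le_ereal_inf_tmp => _ [s [s0 As0] <-].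
rewrite lee_fin leNgt; apply/negP => s2.
have [b b1 bs] := theta_large s2.
have : (hausdorff_pre s 1 A <= hausdorff_measure s A)%E.
  by apply: ereal_sup_ubound; exists 1 => //=.
move=> /(le_trans (hausdorff_pre_ge b1 bs UA)); rewrite As0 lee_fin.
apply/negP; rewrite -ltNge invr_gt0 mulr_gt0// exprn_gt0// ltr0n ltnW//.
Qed.

Theorem theorem1p1 (R : realType) :
  (* (i) *)
  (~ closed (@Uset R) /\
   [/\ closure (@Uset R) !=set0, closed (closure (@Uset R)),
       interior (closure (@Uset R)) = set0 &
       forall p : R * R, ~ isolated (closure (@Uset R)) p]) /\
  (* (ii) *)
  ((@lebesgue2 R).-negligible (@Uset R) /\
   (@lebesgue2 R).-negligible (closure (@Uset R))) /\
  (* (iii) *)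
  (hausdorff_dim (@Uset R) = 2%:E /\ hausdorff_dim (closure (@Uset R)) = 2%:E).
Proof.
split; [|split].
- split; first exact: Uset_not_closed.
  split.
  + by exists (0, 2); apply: subset_closure; apply: Uset_zero; rewrite ltr1n.
  + exact: closed_closure.
  + exact: interior_closure_Uset.
  + exact: closure_Uset_no_isolated.
- split; last exact: closure_Uset_negligible.
  by apply: negligibleS closure_Uset_negligible; exact: subset_closure.
- split; apply/eqP; rewrite eq_le hausdorff_dim_le2 hausdorff_dim_ge2//.
  exact: subset_closure.
Qed.
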